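(* For no constant $\varepsilon>0$ does there exist a $\left(\frac32-\varepsilon\right)$-competitive online algorithm for $1|jrp,s=1,p_j=1,r_j|\sum C_j+c_\mathcal{Q}$.
   Context: Problem $1|jrp,s=1,p_j=1,r_j|\sum C_j+c_\mathcal{Q}$: jobs with processing time $1$ and nonnegative integer release dates $r_j$ must be processed non-preemptively on a single machine (at most one job at a time). There is a single resource, required by every job; each replenishment of it costs $K:=K_0+K_1\ge0$ (part of the instance). A solution consists of start times $S_j$ (completion times $C_j=S_j+1$) and replenishment times $t_1<\dots<t_q$; it is feasible if no two jobs overlap and for each job $j$ some replenishment time lies in $[r_j,S_j]$. Its cost is $\sum_jC_j+qK$. Online setting: jobs are not known in advance (neither their number nor their data); a job becomes known at its release date, and replenishment and scheduling decisions cannot be revoked. An online algorithm is $c$-competitive if on every instance its cost is at most $c$ times the optimal offline cost. *)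

(* Defs.v *)
From mathcomp Require Import all_boot all_order all_algebra.
From mathcomp Require Import boolp classical_sets reals.
Set Implicit Arguments.
Unset Strict Implicit.
Unset Printing Implicit Defensive.
Import Order.TTheory GRing.Theory Num.Theory.
Local Open Scope classical_set_scope.
Local Open Scope ring_scope.

(* [release] lists the release dates of the jobs in nondecreasing order, so the
   index of a job is its arrival rank and reveals nothing about later jobs. *)
Record instance (R : realType) := Instance {
  repl_cost : R;
  release : seq nat;
  repl_cost_ge0 : 0 <= repl_cost;
  release_sorted : sorted leq release
}.

Definition njobs (R : realType) (I : instance R) : nat := size (release I).

(* Only the values [start j] with j smaller than the number of jobs matter. *)
Record solution (R : realType) := Solution {
  start : nat -> R;
  repl : seq R
}.

Definition feasible (R : realType) (I : instance R) (s : solution R) : Prop :=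
  [/\ sorted <%R (repl s),
      forall j k : nat, (j < njobs I)%N -> (k < njobs I)%N -> j <> k ->
        start s j + 1 <= start s k \/ start s k + 1 <= start s j
    & forall j : nat, (j < njobs I)%N ->
        exists2 t : R, t \in repl s &
          (nth 0%N (release I) j)%:R <= t <= start s j].

Definition cost (R : realType) (I : instance R) (s : solution R) : R :=
  \sum_(j < njobs I) (start s j + 1) + (size (repl s))%:R * repl_cost I.

Definition opt_cost (R : realType) (I : instance R) : R :=
  inf [set cost I s | s in [set s | feasible I s]].

Definition known (R : realType) (I : instance R) (t : R) : seq nat :=
  [seq r <- release I | r%:R <= t].

Definition algorithm (R : realType) := instance R -> solution R.

(* Decisions made up to time t, which may be any real number, are determined by
   the replenishment cost and the jobs released up to t, and so are never
   revoked. *)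
Definition nonanticipating (R : realType) (A : algorithm R) : Prop :=
  forall (I I' : instance R) (t : R),
    repl_cost I = repl_cost I' -> known I t = known I' t ->
    (forall u : R, u <= t -> (u \in repl (A I)) = (u \in repl (A I'))) /\
    (forall j : nat, (j < size (known I t))%N ->
       start (A I) j <= t -> start (A I') j = start (A I) j).

Definition online_algorithm (R : realType) (A : algorithm R) : Prop :=
  (forall I : instance R, feasible I (A I)) /\ nonanticipating A.

Definition competitive (R : realType) (c : R) (A : algorithm R) : Prop :=
  forall I : instance R, cost I (A I) <= c * opt_cost I.

(* Main.v *)
Require Import Defs.
From mathcomp Require Import all_boot all_order all_algebra.
From mathcomp Require Import boolp classical_sets reals.
From mathcomp Require Import lra.
Set Implicit Arguments.
Unset Strict Implicit.
Unset Printing Implicit Defensive.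
Import Order.TTheory GRing.Theory Num.Theory.
Local Open Scope ring_scope.

(** The adversary fixes a large replenishment cost K and releases one job at
    time 0.  If the algorithm starts it at a time S >= K/2, no further job
    arrives and the cost is at least 3K/2 + 1 against an optimum of K + 1.  If
    S < K/2, a second job is released at the first integer r > S.  The
    replenishment used by the first job is then useless for the second, so the
    algorithm pays about 2K + 2S, whereas replenishing once at time r costs
    about K + 2S; as S < K/2, the ratio is again at least 3/2 up to O(1/K). *)

Lemma release_le_start (R : realType) (I : instance R) (s : solution R)
    (j : nat) : feasible I s -> (j < njobs I)%N ->
  (nth 0%N (release I) j)%:R <= start s j.
Proof.
move=> [_ _ H] /H [t _ /andP[h1 h2]]; exact: le_trans h1 h2.
Qed.

Lemma cost_ge0 (R : realType) (I : instance R) (s : solution R) :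
  feasible I s -> 0 <= cost I s.
Proof.
move=> fs; apply: addr_ge0.
  apply: sumr_ge0 => j _; apply: addr_ge0 => //.
  exact: le_trans (ler0n _ _) (release_le_start fs (ltn_ord j)).
by apply: mulr_ge0; rewrite ?ler0n ?repl_cost_ge0.
Qed.

Lemma opt_cost_le (R : realType) (I : instance R) (s : solution R) :
  feasible I s -> opt_cost I <= cost I s.
Proof.
move=> fs; apply: ge_inf; last by exists s.
by exists 0 => _ [u fu <-]; exact: cost_ge0.
Qed.

Lemma opt_cost_ge0 (R : realType) (I : instance R) : 0 <= opt_cost I.
Proof.
rewrite /opt_cost; set X := (X in inf X).
(* The infimum of the empty set is 0 by convention, so no feasible solution has to be exhibited
   here. *)
have [->|/set0P X0] := eqVneq X set0; first by rewrite inf0.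
by apply: lb_le_inf X0 _ => _ [u fu <-]; exact: cost_ge0.
Qed.

Lemma competitive_le (R : realType) (c d : R) (A : algorithm R) :
  c <= d -> competitive c A -> competitive d A.
Proof.
move=> cd H I; apply: le_trans (H I) _.
by apply: ler_wpM2r => //; exact: opt_cost_ge0.
Qed.

Lemma competitive_cost_le (R : realType) (c : R) (A : algorithm R)
    (I : instance R) (s : solution R) :
  0 <= c -> competitive c A -> feasible I s -> cost I (A I) <= c * cost I s.
Proof.
move=> c0 H fs; apply: le_trans (H I) _.
by apply: ler_wpM2l => //; exact: opt_cost_le.
Qed.

Lemma size_gt1 (T : eqType) (x y : T) (s : seq T) :
  x \in s -> y \in s -> x != y -> (1 < size s)%N.
Proof.
case: s => [|a [|b s]] //; rewrite !inE => /eqP-> /eqP->; by rewrite eqxx.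
Qed.

Definition one_job (R : realType) (K : R) (K0 : 0 <= K) : instance R :=
  @Instance R K [:: 0%N] K0 isT.

Lemma two_jobs_sorted (r : nat) : sorted leq [:: 0%N; r].
Proof. by []. Qed.

Definition two_jobs (R : realType) (K : R) (K0 : 0 <= K) (r : nat) :
    instance R :=
  Instance K0 (two_jobs_sorted r).

(** The offline comparator in both cases: a single replenishment at [r], then all jobs back to back
    from [r] on. *)
Definition batch (R : realType) (r : nat) : solution R :=
  Solution (fun j => (r + j)%:R) [:: r%:R].

Lemma batch_feasible (R : realType) (I : instance R) (r : nat) :
  (forall j, (j < njobs I)%N -> (nth 0%N (release I) j <= r)%N) ->
  feasible I (batch R r).
Proof.
move=> H; split=> //= [j k _ _ /eqP|j /H jr].
  rewrite -[1]/(1%:R) -!natrD !ler_nat -!addnA !leq_add2l !addn1 neq_ltn.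
  by case/orP=> ?; [left|right].
by exists r%:R; rewrite ?inE ?eqxx // !ler_nat jr leq_addr.
Qed.

Lemma one_job_cost_ge (R : realType) (K : R) (K0 : 0 <= K) (s : solution R) :
  feasible (one_job K0) s -> start s 0 + 1 + K <= cost (one_job K0) s.
Proof.
move=> [_ _ /(_ 0%N isT)[t ts _]]; rewrite /cost /njobs /= big_ord1 lerD2l.
by rewrite -[leLHS]mul1r ler_wpM2r // ler1n; case: (repl s) ts.
Qed.

(** The second job needs a replenishment at or after its release [r], hence different from [t], so
    at least two are paid. *)
Lemma two_jobs_cost_ge (R : realType) (K : R) (K0 : 0 <= K) (r : nat)
    (s : solution R) (t : R) :
  feasible (two_jobs K0 r) s -> t \in repl s -> t < r%:R ->
  start s 0 + r%:R + 2 + 2 * K <= cost (two_jobs K0 r) s.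
Proof.
move=> fs ts tr; have /= r1 := release_le_start fs (isT : (1 < 2)%N).
case: (fs) => _ _ /(_ 1%N isT)[u us /= /andP[ru _]].
have tu : t != u by rewrite lt_eqF // (lt_le_trans tr ru).
have : 2 * K <= (size (repl s))%:R * K.
  by rewrite ler_wpM2r // ler_nat (size_gt1 ts us).
rewrite /cost /njobs /= big_ord_recl big_ord1 /=; lra.
Qed.

Lemma two_jobs_known_lt (R : realType) (K : R) (K0 : 0 <= K) (r : nat) (t : R) :
  0 <= t -> t < r%:R ->
  known (one_job K0) t = [:: 0%N] /\ known (two_jobs K0 r) t = [:: 0%N].
Proof. by move=> t0 tr; rewrite /known /= t0 leNgt tr. Qed.

Lemma two_jobs_same_start (R : realType) (A : algorithm R) (K : R) (K0 : 0 <= K)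
    (r : nat) (S := start (A (one_job K0)) 0) :
  online_algorithm A -> S < r%:R ->
  start (A (two_jobs K0 r)) 0 = S /\
  exists2 t, t \in repl (A (two_jobs K0 r)) & t < r%:R.
Proof.
move=> [fA nA] Sr; have f1 := fA (one_job K0).
have /= S0 : 0 <= S := release_le_start f1 (isT : (0 < 1)%N).
have [k1 k2] := two_jobs_known_lt K0 S0 Sr.
(* At time [S] itself both instances show only the first job, so its start and all replenishments up
   to [S] agree. *)
have [|hr hs] := nA (one_job K0) (two_jobs K0 r) S erefl; first by rewrite k1 k2.
split; first by apply: hs; rewrite ?k1.
case: f1 => _ _ /(_ 0%N isT)[t ts /andP[_ tS]].
by exists t; [rewrite -hr | exact: le_lt_trans tS Sr].
Qed.

Theorem theorem11 (R : realType) (eps : R) (heps : 0 < eps) :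
  ~ exists A : algorithm R,
      online_algorithm A /\ competitive (3 / 2 - eps) A.
Proof.
move=> [A [oA cA0]]; have [fA _] := oA.
(* Capping at 1 keeps the ratio [3 / 2 - e] nonnegative, so upper bounds on the optimum can be
   multiplied by it. *)
pose e := Num.min eps 1.
have e0 : 0 < e by rewrite lt_min heps ltr01.
have e1 : e <= 1 by rewrite ge_min lexx orbT.
have cA : competitive (3 / 2 - e) A.
  by apply: competitive_le cA0; rewrite lerD2l lerN2 ge_min lexx.
have c0 : 0 <= 3 / 2 - e by lra.
(* The additive constants leave a slack of at most 1/2 in the first case and 9/2 in the second;
   [e * K = 5] exceeds both. *)
pose K : R := 5 / e.
have eK : e * K = 5 by rewrite /K mulrC divfK // gt_eqF.
have K0 : 0 <= K by rewrite divr_ge0 // ltW.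
pose S := start (A (one_job K0)) 0.
have S0 : 0 <= S := release_le_start (fA (one_job K0)) (isT : (0 < 1)%N).
have [SK|SK] := leP (K / 2) S.
  have := one_job_cost_ge (fA (one_job K0)).
  have f0 : feasible (one_job K0) (batch R 0) by apply: batch_feasible => -[].
  have := competitive_cost_le c0 cA f0.
  rewrite [cost _ (batch _ _)]/cost /njobs /= big_ord1 /= -/S; nra.
(* [S] may be an integer, so the successor is what gives strict [S < r], while still
   [r <= S + 1]. *)
pose r := (Num.truncn S).+1.
have Sr : S < r%:R by exact: truncnS_gt.
have rS : r%:R <= S + 1 by rewrite -natr1 lerD2r truncn_le.
have [eS [t ts tr]] := two_jobs_same_start oA Sr.
have := two_jobs_cost_ge (fA (two_jobs K0 r)) ts tr; rewrite eS -/S.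
have fr : feasible (two_jobs K0 r) (batch R r) by apply: batch_feasible => -[|[]].
have := competitive_cost_le c0 cA fr.
rewrite [cost _ (batch _ _)]/cost /njobs /= big_ord_recl big_ord1 /=.
(* The bounds to refute read [S + r + 2 + 2 * K <= (3 / 2 - e) * (2 * r + 3 + K)]; with [r <= S + 1]
   they force [K / 2 + e * K <= S + 9 / 2], against [S < K / 2]. *)
rewrite /bump addn0 addn1 -natr1; nra.
Qed.
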